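(* Consider quantum systems composed by the tensor product, with state set $\Omega$ all density matrices, symmetry given by complex conjugation, and effect set $\mathcal E_{\max}=\{E\text{ Hermitian}:0\le\Gamma_S(E)\le\mathbb I\ \text{for every subset }S\text{ of wires}\}$. Let $\mathcal O'$ be any operation class making $(\Omega,\mathcal E_{\max},\mathcal O')$ a valid generalized probabilistic theory. If $\mathcal O'$ is sectorially closed, then $\mathcal O'$ is contained in the completely PPT-preserving class. That class is therefore the largest sectorially closed operation class compatible with unrestricted states and the effect set $\mathcal E_{\max}$.
   Context: A wire carries a finite-dimensional complex Hilbert space with a fixed orthonormal basis; a system is a finite list of wires composed by the tensor product; $\Gamma_S$ is partial transposition in the fixed bases on the wires in $S$. A linear map $\Lambda:\mathcal L(\mathcal H_{\rm in})\to\mathcal L(\mathcal H_{\rm out})$ has its input and output wires labelled by a common index set (each label on at most one input and one output wire), and $\Gamma_V\circ\Lambda\circ\Gamma_V$ transposes the input wires with label in $V$, applies $\Lambda$, and transposes the output wires with label in $V$. The completely PPT-preserving class consists of the trace-preserving maps $\Lambda$ such that $\Gamma_V\circ\Lambda\circ\Gamma_V$ is completely positive for every set $V$ of labels. An operation class $\mathcal O'$ (a set of trace-preserving linear maps between systems) makes $(\Omega,\mathcal E_{\max},\mathcal O')$ a valid generalized probabilistic theory (''is compatible with'' the states and effects) if it contains the identities, is convex, is closed under sequential and parallel composition, every $\Lambda\in\mathcal O'$ maps states to states, and $\Lambda^*$ maps $\mathcal E_{\max}$ into $\mathcal E_{\max}$. It is sectorially closed if $\Lambda\in\mathcal O'$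 implies $\Gamma_V\circ\Lambda\circ\Gamma_V\in\mathcal O'$ for every $V$. *)

(* Defs.v *)
From HB Require Import structures.
From mathcomp Require Import all_boot all_order all_algebra.
From mathcomp Require Import reals complex.

Set Implicit Arguments.
Unset Strict Implicit.
Unset Printing Implicit Defensive.

Import Order.TTheory GRing.Theory Num.Theory.
Local Open Scope ring_scope.
Local Open Scope sesquilinear_scope.

Record wire := Wire { label : nat; dim : nat }.

(* Labels name the wires inside a system, so a subset of the wires of a system *)
(* is given by a set of labels; across a map, an input and an output wire with *)
(* the same label are the ones that Gamma_V transposes together. Two systems   *)
(* compose in parallel exactly when their concatenation is again a system.     *)
Definition is_system (A : seq wire) : bool :=
  uniq (map label A) && all (fun w => 0 < dim w)%N A.

(* The product basis of the tensor product of the wires. *)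
Fixpoint basis (A : seq wire) : finType :=
  if A is w :: A' then ('I_(dim w) * basis A')%type : finType else unit : finType.

Fixpoint bsplit (A B : seq wire) : basis (A ++ B) -> basis A * basis B :=
  match A return basis (A ++ B) -> basis A * basis B with
  | [::] => fun b => (tt, b)
  | w :: A' => fun k => let ab := @bsplit A' B k.2 in ((k.1, ab.1), ab.2)
  end.

(* The basis vector equal to b on the wires with label in V and to a elsewhere. *)
Fixpoint bmix (V : pred nat) (A : seq wire) : basis A -> basis A -> basis A :=
  match A return basis A -> basis A -> basis A with
  | [::] => fun _ _ => tt
  | w :: A' => fun a b =>
      ((if V (label w) then b.1 else a.1), @bmix V A' a.2 b.2)
  end.

Section Theory.
Variable C : numClosedFieldType.
Implicit Types (V : pred nat) (A B : seq wire).

Definition Op A := 'M[C]_#|basis A|.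

Definition entry A (X : Op A) (a b : basis A) : C := X (enum_rank a) (enum_rank b).

Definition mkop A (f : basis A -> basis A -> C) : Op A :=
  \matrix_(i, j) f (enum_val i) (enum_val j).

Lemma entry_mkop A (f : basis A -> basis A -> C) a b : entry (mkop f) a b = f a b.
Proof. by rewrite /entry mxE !enum_rankK. Qed.

Lemma op_ext A (X Y : Op A) : (forall a b, entry X a b = entry Y a b) -> X = Y.
Proof.
move=> eXY; apply/matrixP=> i j.
by have := eXY (enum_val i) (enum_val j); rewrite /entry !enum_valK.
Qed.

Lemma entry_lin A a (X Y : Op A) b c :
  entry (a *: X + Y) b c = a * entry X b c + entry Y b c.
Proof. by rewrite /entry !mxE. Qed.

(* The matrix unit |a><b|. *)
Definition munit A (a b : basis A) : Op A := delta_mx (enum_rank a) (enum_rank b).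

Definition otens A B (X : Op A) (Y : Op B) : Op (A ++ B) :=
  mkop (fun k l => entry X (bsplit k).1 (bsplit l).1 *
                   entry Y (bsplit k).2 (bsplit l).2).

Definition ptrans V A (X : Op A) : Op A :=
  mkop (fun a b => entry X (bmix V a b) (bmix V b a)).

Lemma ptrans_linear V A : linear (@ptrans V A).
Proof.
by move=> a X Y; apply/op_ext=> b c; rewrite entry_lin !entry_mkop entry_lin.
Qed.

HB.instance Definition _ V A :=
  GRing.isLinear.Build C (Op A) (Op A) *:%R (@ptrans V A) (@ptrans_linear V A).

Definition Gamma V A : 'End(Op A) := linfun (@ptrans V A).

Lemma GammaE V A X : Gamma V A X = ptrans V X.
Proof. by rewrite lfunE. Qed.

Definition psd n (X : 'M[C]_n) : Prop :=
  forall v : 'cV[C]_n, 0 <= (v^t* *m X *m v) 0 0.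

Definition state A (rho : Op A) : Prop := psd rho /\ \tr rho = 1.

Definition effect_max A (E : Op A) : Prop :=
  E \is hermsymmx /\
  forall V : pred nat, psd (Gamma V A E) /\ psd (1%:M - Gamma V A E).

Definition ltens_fun A1 B1 A2 B2 (f : 'Hom(Op A1, Op B1)) (g : 'Hom(Op A2, Op B2))
    (Z : Op (A1 ++ A2)) : Op (B1 ++ B2) :=
  \sum_k \sum_l entry Z k l *:
    otens (f (munit (bsplit k).1 (bsplit l).1)) (g (munit (bsplit k).2 (bsplit l).2)).

Lemma ltens_linear A1 B1 A2 B2 (f : 'Hom(Op A1, Op B1)) (g : 'Hom(Op A2, Op B2)) :
  linear (ltens_fun f g).
Proof.
move=> a X Y; rewrite /ltens_fun scaler_sumr -big_split; apply: eq_bigr => k _ /=.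
rewrite scaler_sumr -big_split; apply: eq_bigr => l _ /=.
by rewrite entry_lin scalerDl scalerA.
Qed.

HB.instance Definition _ A1 B1 A2 B2 (f : 'Hom(Op A1, Op B1))
    (g : 'Hom(Op A2, Op B2)) :=
  GRing.isLinear.Build C (Op (A1 ++ A2)) (Op (B1 ++ B2)) *:%R (ltens_fun f g)
    (ltens_linear f g).

Definition ltens A1 B1 A2 B2 (f : 'Hom(Op A1, Op B1)) (g : 'Hom(Op A2, Op B2)) :
  'Hom(Op (A1 ++ A2), Op (B1 ++ B2)) := linfun (ltens_fun f g).

(* The adjoint for the Hilbert-Schmidt product (X, Y) |-> tr(X^* Y), see *)
(* ladjP; the entry (a, b) of an operator is its product with |a><b|.   *)
Definition ladj_fun A B (f : 'Hom(Op A, Op B)) (Y : Op B) : Op A :=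
  mkop (fun a b => \tr ((f (munit a b))^t* *m Y)).

Lemma ladj_linear A B (f : 'Hom(Op A, Op B)) : linear (ladj_fun f).
Proof.
move=> a X Y; apply/op_ext=> b c; rewrite entry_lin !entry_mkop.
by rewrite mulmxDr -scalemxAr mxtraceD mxtraceZ.
Qed.

HB.instance Definition _ A B (f : 'Hom(Op A, Op B)) :=
  GRing.isLinear.Build C (Op B) (Op A) *:%R (ladj_fun f) (ladj_linear f).

Definition ladj A B (f : 'Hom(Op A, Op B)) : 'Hom(Op B, Op A) := linfun (ladj_fun f).

Lemma op_sum_units A (X : Op A) : X = \sum_a \sum_b entry X a b *: munit a b.
Proof.
apply/op_ext=> a b; rewrite /entry summxE (bigD1 a) //= summxE (bigD1 b) //=.
rewrite /munit !mxE !eqxx mulr1 big1 ?addr0 => [|b' nb]; last first.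
  by rewrite !mxE !(inj_eq enum_rank_inj) [b == b']eq_sym (negPf nb) andbF mulr0.
rewrite big1 ?addr0 // => a' na; rewrite summxE big1 // => b' _.
by rewrite !mxE !(inj_eq enum_rank_inj) [a == a']eq_sym (negPf na) mulr0.
Qed.

Lemma bsplit_bij A B : bijective (@bsplit A B).
Proof.
elim: A => [|w A [g gK Kg]] /=.
  by exists snd => [//|[[] b]].
exists (fun ab => (ab.1.1, g (ab.1.2, ab.2))) => [[i k]|[[i a] b]] /=.
  by rewrite -surjective_pairing gK.
by rewrite Kg.
Qed.

Lemma entry_lfun A B (f : 'Hom(Op A, Op B)) X s t :
  entry (f X) s t = \sum_a \sum_b entry X a b * entry (f (munit a b)) s t.
Proof.
rewrite [in LHS](op_sum_units X) linear_sum /= /entry summxE.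
apply: eq_bigr => a _; rewrite linear_sum summxE; apply: eq_bigr => b _ /=.
by rewrite linearZ mxE.
Qed.

Lemma ltens_otens A1 B1 A2 B2 (f : 'Hom(Op A1, Op B1)) (g : 'Hom(Op A2, Op B2)) X Y :
  ltens f g (otens X Y) = otens (f X) (g Y).
Proof.
rewrite lfunE /= /ltens_fun; apply/op_ext=> s t.
have bij : {on [pred p | true], bijective (@bsplit A1 A2)}.
  exact/onW_bij/bsplit_bij.
pose F a b := entry X a b * entry (f (munit a b)) (bsplit s).1 (bsplit t).1.
pose G a b := entry Y a b * entry (g (munit a b)) (bsplit s).2 (bsplit t).2.
transitivity (\sum_p \sum_q F p.1 q.1 * G p.2 q.2).
  rewrite (reindex _ bij) /= {1}/entry summxE; apply: eq_bigr => k _.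
  rewrite (reindex _ bij) /= summxE; apply: eq_bigr => l _.
  by rewrite mxE -[otens (f _) _ _ _]/(entry _ s t) !entry_mkop mulrACA.
rewrite /otens entry_mkop !entry_lfun mulr_suml.
rewrite -(pair_big predT predT (fun a a' => \sum_q F a q.1 * G a' q.2)) /=.
apply: eq_bigr => a _; rewrite mulr_sumr; apply: eq_bigr => a' _.
rewrite -(pair_big predT predT (fun b b' => F a b * G a' b')) /= mulr_suml.
by apply: eq_bigr => b _; rewrite mulr_sumr.
Qed.

Lemma hs_entry A (X Y : Op A) :
  \tr (X^t* *m Y) = \sum_p (entry X p.1 p.2)^* * entry Y p.1 p.2.
Proof.
rewrite -(pair_big predT predT (fun a b => (entry X a b)^* * entry Y a b)) /=.
have rk : {on [pred i | true], bijective (@enum_rank (basis A))}.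
  exact/onW_bij/enum_rank_bij.
rewrite /mxtrace (reindex _ rk) exchange_big /=; apply: eq_bigr => b _.
by rewrite mxE (reindex _ rk); apply: eq_bigr => a _; rewrite !mxE.
Qed.

Lemma ladjP A B (f : 'Hom(Op A, Op B)) X Y :
  \tr ((f X)^t* *m Y) = \tr (X^t* *m ladj f Y).
Proof.
rewrite [LHS]hs_entry [RHS]hs_entry lfunE /=.
under [RHS]eq_bigr => p _ do rewrite entry_mkop hs_entry mulr_sumr.
rewrite [RHS]exchange_big; apply: eq_bigr => q _ /=.
rewrite entry_lfun pair_big rmorph_sum mulr_suml; apply: eq_bigr => p _ /=.
by rewrite rmorphM mulrA.
Qed.

Definition trace_preserving A B (L : 'Hom(Op A, Op B)) : Prop :=
  forall X : Op A, \tr (L X) = \tr X.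

(* The label of the ancillary wire plays no role here. *)
Definition completely_positive A B (L : 'Hom(Op A, Op B)) : Prop :=
  forall (n : nat) (X : Op (A ++ [:: Wire 0 n])),
    psd X -> psd (ltens L (\1%VF : 'End(Op [:: Wire 0 n])) X).

Definition sector V A B (L : 'Hom(Op A, Op B)) : 'Hom(Op A, Op B) :=
  (Gamma V B \o L \o Gamma V A)%VF.

Definition op_class := forall A B : seq wire, 'Hom(Op A, Op B) -> Prop.

Definition PPT_class : op_class := fun A B L =>
  [/\ is_system A, is_system B, trace_preserving L &
      forall V, completely_positive (sector V L)].

Definition sub_class (O1 O2 : op_class) : Prop :=
  forall A B (L : 'Hom(Op A, Op B)), O1 A B L -> O2 A B L.

Definition sectorially_closed (O : op_class) : Prop :=
  forall V A B (L : 'Hom(Op A, Op B)), O A B L -> O A B (sector V L).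

Record valid_gpt (Omega Eff : forall A, Op A -> Prop) (O : op_class) : Prop := {
  gpt_systems : forall A B (L : 'Hom(Op A, Op B)), O A B L ->
    is_system A /\ is_system B;
  gpt_tp : forall A B (L : 'Hom(Op A, Op B)), O A B L -> trace_preserving L;
  gpt_id : forall A, is_system A -> O A A \1%VF;
  gpt_convex : forall A B (L M : 'Hom(Op A, Op B)) (t : C), 0 <= t <= 1 ->
    O A B L -> O A B M -> O A B (t *: L + (1 - t) *: M);
  gpt_comp : forall A B D (L : 'Hom(Op A, Op B)) (M : 'Hom(Op B, Op D)),
    O A B L -> O B D M -> O A D (M \o L)%VF;
  gpt_tens : forall A1 B1 A2 B2 (L : 'Hom(Op A1, Op B1)) (M : 'Hom(Op A2, Op B2)),
    is_system (A1 ++ A2) -> is_system (B1 ++ B2) ->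
    O A1 B1 L -> O A2 B2 M -> O (A1 ++ A2) (B1 ++ B2) (ltens L M);
  gpt_states : forall A B (L : 'Hom(Op A, Op B)) (rho : Op A), O A B L ->
    Omega A rho -> Omega B (L rho);
  gpt_effects : forall A B (L : 'Hom(Op A, Op B)) (E : Op B), O A B L ->
    Eff B E -> Eff A (ladj L E)
}.

End Theory.

(* Main.v *)
(** By Choi's theorem a map is completely positive exactly when it has a Kraus
    decomposition X |-> sum_i K_i X K_i^*. An operation of a class [O'] stays a
    state-preserving operation after adding an idle ancilla with a fresh label;
    applied to a maximally entangled state this makes it completely positive,
    and sectorial closure extends this to all its partial transposes.
    Conversely, Kraus form passes to identities, mixtures, compositions, tensor
    products and adjoints, and the involution [sector V] commutes with all of
    these. So, for [L] completely PPT-preserving and [E] in [E_max],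
    Gamma_V (L^* E) = (sector V L)^* (Gamma_V E) with (sector V L)^* positive
    and unital, whence it lies between 0 and 1. *)
Require Import Defs.
From mathcomp Require Import all_boot all_order all_algebra.
From mathcomp Require Import reals complex.

Set Implicit Arguments.
Unset Strict Implicit.
Unset Printing Implicit Defensive.

Import Order.TTheory GRing.Theory Num.Theory.
Local Open Scope ring_scope.
Local Open Scope sesquilinear_scope.

(** * Positive semidefinite complex matrices *)

Section Psd.
Variable C : numClosedFieldType.

Lemma adj_mul m n p (X : 'M[C]_(m, n)) (Y : 'M_(n, p)) :
  (X *m Y)^t* = Y^t* *m X^t*.
Proof. by rewrite trmx_mul map_mxM. Qed.

Lemma psd_conj m n (X : 'M[C]_n) (K : 'M_(m, n)) :
  psd X -> psd (K *m X *m K^t*).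
Proof.
move=> pX v; have := pX (K^t* *m v).
by rewrite adj_mul trmxCK !mulmxA.
Qed.

Lemma psd_sum n (I : finType) (X : I -> 'M[C]_n) :
  (forall i, psd (X i)) -> psd (\sum_i X i).
Proof.
move=> pX v; rewrite mulmx_sumr mulmx_suml summxE.
by apply: sumr_ge0 => i _; exact: pX.
Qed.

Lemma psdZ n c (X : 'M[C]_n) : 0 <= c -> psd X -> psd (c *: X).
Proof.
by move=> c0 pX v; rewrite -scalemxAr -scalemxAl mxE mulr_ge0 //; exact: pX.
Qed.

Lemma psd_gram m n (W : 'M[C]_(m, n)) : psd (W *m W^t*).
Proof.
move=> v; rewrite mulmxA -[v^t* *m W *m _ *m v]mulmxA.
rewrite -[X in X *m _]trmxCK adj_mul trmxCK mxE sumr_ge0 // => i _.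
by rewrite !mxE mulrC mul_conjC_ge0.
Qed.

Lemma qform_delta m n (X : 'M[C]_(m, n)) i j :
  ((delta_mx i 0 : 'cV_m)^t* *m X *m (delta_mx j 0 : 'cV_n)) 0 0 = X i j.
Proof.
rewrite -mulmxA -colE trmx_delta map_delta_mx -rowE.
by rewrite !mxE.
Qed.

(** Polarisation over the complex field: no symmetry of [D] is assumed, so the form is tested at
    [d i + c *: d j] for a free scalar [c]. *)
Lemma qform_eq0 n (D : 'M[C]_n) :
  (forall v : 'cV_n, (v^t* *m D *m v) 0 0 = 0) -> D = 0.
Proof.
move=> D0; pose d i : 'cV[C]_n := delta_mx i 0.
have E i j c : c * D i j + c^* * D j i = 0.
  have addE (X Y : 'M[C]_1) : (X + Y) 0 0 = X 0 0 + Y 0 0 by rewrite mxE.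
  have scaleE a (X : 'M[C]_1) : (a *: X) 0 0 = a * X 0 0 by rewrite mxE.
  have := D0 (d i + c *: d j).
  rewrite [(_ + _)^T]linearD /= [(_ *: _)^T]linearZ /= map_mxD map_mxZ.
  rewrite !mulmxDl !mulmxDr.
  rewrite -!scalemxAl -!scalemxAr !addE !scaleE.
  by rewrite !D0 !qform_delta !mulr0 add0r addr0 addrC.
apply/matrixP=> i j; rewrite mxE; apply/eqP.
(* [c = 1] makes [D] antisymmetric and [c = 'i] makes it symmetric. *)
have /eqP := E i j 1; rewrite rmorph1 !mul1r addr_eq0 => /eqP Dij.
have /eqP := E i j 'i; rewrite conjCi mulNr -mulrBr mulf_eq0 (negPf (neq0Ci C)) /=.
by rewrite Dij -opprD oppr_eq0 -mulr2n mulrn_eq0 /= => /eqP->; rewrite oppr0.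
Qed.

(** [psd] does not include hermiticity. It follows because nonnegative values are real, so the form
    of [X^t* - X] vanishes. *)
Lemma psd_adj n (X : 'M[C]_n) : psd X -> X^t* = X.
Proof.
move=> pX; apply/eqP; rewrite -subr_eq0; apply/eqP/qform_eq0 => v.
have conjE (Y : 'M[C]_1) : (Y^t*) 0 0 = (Y 0 0)^* by rewrite !mxE.
have subE (Y Z : 'M[C]_1) : (Y - Z) 0 0 = Y 0 0 - Z 0 0 by rewrite !mxE.
rewrite mulmxBr mulmxBl subE; apply/eqP; rewrite subr_eq0.
have -> : v^t* *m X^t* *m v = (v^t* *m X *m v)^t*.
  by rewrite !adj_mul trmxCK mulmxA.
by rewrite conjE; apply/eqP/CrealP/ger0_real/pX.
Qed.

Lemma hermsymmx_adj n (X : 'M[C]_n) : X^t* = X -> X \is hermsymmx.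
Proof. by move=> hX; apply/is_hermitianmxP; rewrite expr0 scale1r. Qed.

(** Diagonalise [X] by a unitary [P]; the factor is [P^t*] times the square root of the diagonal
    part. *)
Lemma psd_gramP n (X : 'M[C]_n) :
  psd X -> exists W : 'M[C]_n, X = W *m W^t*.
Proof.
move=> pX; have nX := hermitian_normalmx (hermsymmx_adj (psd_adj pX)).
have := orthomx_spectralP nX; set P := spectralmx X; set d := spectral_diag X.
have uP : P \is unitarymx := spectral_unitarymx X.
rewrite invmx_unitary // => eX.
(* The eigenvalues are the diagonal entries of [P *m X *m P^t*]. *)
have d0 i : 0 <= d 0 i.
  have := psd_conj P pX (delta_mx i 0).
  rewrite qform_delta eX !mulmxA (unitarymxP uP) mul1mx -mulmxA.
  by rewrite (unitarymxP uP) mulmx1 mxE eqxx mulr1n.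
exists (P^t* *m diag_mx (\row_i sqrtC (d 0 i))).
rewrite adj_mul trmxCK eX -!mulmxA; congr (_ *m _); rewrite !mulmxA.
congr (_ *m _); apply/matrixP=> i j; rewrite tr_diag_mx map_diag_mx mulmx_diag.
rewrite !mxE; congr (_ *+ _).
have /CrealP eC : sqrtC (d 0 i) \is Num.real by rewrite ger0_real ?sqrtC_ge0.
by rewrite [X in _ * X]eC -expr2 sqrtCK.
Qed.

Lemma psd_tr_ge0 n (X : 'M[C]_n) : psd X -> 0 <= \tr X.
Proof. by move=> pX; apply: sumr_ge0 => i _; rewrite -qform_delta; exact: pX. Qed.

(** In a Gram factorisation the trace is the sum of the squared moduli of all entries of [W], so [W]
    vanishes with it. *)
Lemma psd_tr0 n (X : 'M[C]_n) : psd X -> \tr X = 0 -> X = 0.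
Proof.
move=> pX /eqP; have [W eX] := psd_gramP pX.
have eW i : X i i = \sum_j W i j * (W i j)^*.
  by rewrite eX mxE; apply: eq_bigr => j _; rewrite !mxE.
have W0 i : 0 <= X i i by rewrite eW sumr_ge0 // => j _; exact: mul_conjC_ge0.
rewrite /mxtrace psumr_eq0 // => /allP X0; rewrite eX.
suff -> : W = 0 by rewrite mul0mx.
apply/matrixP=> i j; have := X0 i (mem_index_enum i).
rewrite /= eW psumr_eq0 => [/allP/(_ j (mem_index_enum j))|k _].
  by rewrite /= mul_conjC_eq0 mxE => /eqP.
exact: mul_conjC_ge0.
Qed.

End Psd.

(** * Kraus decompositions, adjoints and Choi's theorem *)

Section Kraus.
Variable C : numClosedFieldType.
Implicit Types (V : pred nat) (A B D : seq wire).

Lemma entry_munit A (a b s t : basis A) :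
  entry (munit C a b) s t = ((s == a) && (t == b))%:R.
Proof. by rewrite /entry mxE !(inj_eq enum_rank_inj). Qed.

Lemma entry_sum A (I : finType) (F : I -> Op C A) s t :
  entry (\sum_i F i) s t = \sum_i entry (F i) s t.
Proof. exact: summxE. Qed.

Lemma entryZ A c (X : Op C A) s t : entry (c *: X) s t = c * entry X s t.
Proof. exact: mxE. Qed.

Lemma entry_otens A B (X : Op C A) (Y : Op C B) k l :
  entry (otens X Y) k l = entry X (bsplit k).1 (bsplit l).1 *
                          entry Y (bsplit k).2 (bsplit l).2.
Proof. exact: entry_mkop. Qed.

Lemma mxtrace_entry A (X : Op C A) : \tr X = \sum_a entry X a a.
Proof. by rewrite /mxtrace (reindex _ (onW_bij _ (@enum_rank_bij (basis A)))). Qed.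

Lemma mxtrace_otens A B (X : Op C A) (Y : Op C B) :
  \tr (otens X Y) = \tr X * \tr Y.
Proof.
have bij : {on [pred p | true], bijective (@bsplit A B)} := onW_bij _ (bsplit_bij A B).
rewrite !mxtrace_entry big_distrlr pair_big (reindex _ bij) /=.
by apply: eq_bigr => k _; rewrite entry_otens.
Qed.

Lemma munit_split A B (k l : basis (A ++ B)) :
  munit C k l = otens (munit C (bsplit k).1 (bsplit l).1)
                      (munit C (bsplit k).2 (bsplit l).2).
Proof.
have E (x y : basis (A ++ B)) :
    (x == y) = ((bsplit x).1 == (bsplit y).1) && ((bsplit x).2 == (bsplit y).2).
  by rewrite -xpair_eqE -!surjective_pairing (inj_eq (bij_inj (bsplit_bij A B))).
apply/op_ext=> s t; rewrite entry_otens !entry_munit !E -natrM mulnb.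
by rewrite andbACA.
Qed.

Lemma entry_conj_munit A B (K : 'M[C]_(#|basis B|, #|basis A|)) a b s t :
  entry (K *m munit C a b *m K^t* : Op C B) s t =
  K (enum_rank s) (enum_rank a) * (K (enum_rank t) (enum_rank b))^*.
Proof.
(* Writing the matrix unit as a column times a row turns the product into a column of [K] times a
   conjugated row. *)
rewrite /entry /munit -(mul_delta_mx (0 : 'I_1)) mulmxA -colE -mulmxA -rowE.
by rewrite mxE big_ord1 !mxE.
Qed.

Definition kraus_map A B (I : finType)
    (K : I -> 'M[C]_(#|basis B|, #|basis A|)) (X : Op C A) : Op C B :=
  \sum_i K i *m X *m (K i)^t*.

Definition kraus A B (L : 'Hom(Op C A, Op C B)) : Prop :=
  exists (I : finType) (K : I -> 'M_(#|basis B|, #|basis A|)), L =1 kraus_map K.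

(** By linearity the matrix units suffice. This scalar form lets tensor products, adjoints and
    Choi's theorem be checked entry by entry. *)
Lemma kraus_mapP A B (I : finType) (K : I -> 'M_(#|basis B|, #|basis A|))
    (L : 'Hom(Op C A, Op C B)) :
  L =1 kraus_map K <-> forall a b s t, entry (L (munit C a b)) s t =
    \sum_i K i (enum_rank s) (enum_rank a) * (K i (enum_rank t) (enum_rank b))^*.
Proof.
split=> [eL a b s t|eL X].
  by rewrite eL entry_sum; apply: eq_bigr => i _; rewrite entry_conj_munit.
apply/op_ext=> s t; rewrite entry_lfun entry_sum.
under eq_bigr => a _ do under eq_bigr => b _ do rewrite eL mulr_sumr.
under eq_bigr => a _ do rewrite exchange_big.
rewrite exchange_big; apply: eq_bigr => i _.
rewrite {2}(op_sum_units X) mulmx_sumr mulmx_suml entry_sum.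
apply: eq_bigr => a _; rewrite mulmx_sumr mulmx_suml entry_sum.
apply: eq_bigr => b _; rewrite -scalemxAr -scalemxAl -entry_conj_munit.
by rewrite entryZ.
Qed.

Lemma kraus_psd A B (L : 'Hom(Op C A, Op C B)) X :
  kraus L -> psd X -> psd (L X).
Proof.
by move=> [I [K ->]] pX; apply: psd_sum => i; exact: psd_conj.
Qed.

Lemma kraus_id A : kraus (\1%VF : 'End(Op C A)).
Proof.
exists unit, (fun=> 1%:M) => X; rewrite lfunE /= /kraus_map big_const card_unit /=.
by rewrite addr0 trmx1 map_mx1 mulmx1 mul1mx.
Qed.

Lemma kraus_comp A B D (L : 'Hom(Op C A, Op C B)) (M : 'Hom(Op C B, Op C D)) :
  kraus L -> kraus M -> kraus (M \o L)%VF.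
Proof.
move=> [I [K eL]] [J [N eM]]; exists (J * I)%type, (fun p => N p.1 *m K p.2) => X.
rewrite lfunE /= eM eL /kraus_map.
rewrite -(pair_big predT predT
  (fun j i => N j *m K i *m X *m (N j *m K i)^t*)) /=.
apply: eq_bigr => j _; rewrite mulmx_sumr mulmx_suml.
by apply: eq_bigr => i _; rewrite adj_mul !mulmxA.
Qed.

(** The square roots of the weights are absorbed into the Kraus operators, and the two families are
    put side by side. *)
Lemma kraus_conic A B (L M : 'Hom(Op C A, Op C B)) (x y : C) :
  0 <= x -> 0 <= y -> kraus L -> kraus M -> kraus (x *: L + y *: M).
Proof.
move=> x0 y0 [I [K eL]] [J [N eM]].
exists (I + J)%type, (fun p => match p with
  inl i => sqrtC x *: K i | inr j => sqrtC y *: N j end) => X.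
have E z m n (Q : 'M[C]_(m, n)) (Y : 'M_n) : 0 <= z ->
    (sqrtC z *: Q) *m Y *m (sqrtC z *: Q)^t* = z *: (Q *m Y *m Q^t*).
  move=> z0; have /CrealP eC : sqrtC z \is Num.real by rewrite ger0_real ?sqrtC_ge0.
  rewrite [(_ *: _)^T]linearZ /= map_mxZ -!scalemxAl -scalemxAr scalerA.
  by rewrite [X in _ * X]eC -expr2 sqrtCK.
rewrite !lfunE /= !lfunE /= eL eM /kraus_map big_sumType /= !scaler_sumr.
by congr (_ + _); apply: eq_bigr => i _; rewrite E.
Qed.

Lemma kraus_tens A1 B1 A2 B2 (L : 'Hom(Op C A1, Op C B1))
    (M : 'Hom(Op C A2, Op C B2)) : kraus L -> kraus M -> kraus (ltens L M).
Proof.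
move=> [I [K /kraus_mapP eL]] [J [N /kraus_mapP eM]].
(* The Kronecker products of the Kraus operators, with indices read through [bsplit]. *)
exists (I * J)%type, (fun p => \matrix_(s, a)
  (K p.1 (enum_rank (bsplit (enum_val s)).1) (enum_rank (bsplit (enum_val a)).1) *
   N p.2 (enum_rank (bsplit (enum_val s)).2) (enum_rank (bsplit (enum_val a)).2))).
apply/kraus_mapP=> k l s t; rewrite munit_split ltens_otens entry_otens eL eM.
rewrite big_distrlr pair_big /=; apply: eq_bigr => p _.
by rewrite !mxE !enum_rankK rmorphM mulrACA.
Qed.

Lemma hs_munit A (X : Op C A) s t : \tr (X^t* *m munit C s t) = (entry X s t)^*.
Proof.
rewrite hs_entry (bigD1 (s, t)) //= entry_munit !eqxx mulr1 big1 ?addr0 // => p.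
by rewrite entry_munit -xpair_eqE -surjective_pairing => /negPf->; rewrite mulr0.
Qed.

Lemma entry_ladj A B (L : 'Hom(Op C A, Op C B)) Y a b :
  entry (ladj L Y) a b = \tr ((L (munit C a b))^t* *m Y).
Proof. by rewrite lfunE entry_mkop. Qed.

Lemma kraus_ladj A B (L : 'Hom(Op C A, Op C B)) : kraus L -> kraus (ladj L).
Proof.
move=> [I [K /kraus_mapP eL]]; exists I, (fun i => (K i)^t*).
apply/kraus_mapP=> s t a b; rewrite entry_ladj hs_munit eL rmorph_sum.
by apply: eq_bigr => i _; rewrite rmorphM !mxE.
Qed.

(** Pairing with the identity is the trace, up to conjugation, so trace preservation of [L] dualises
    to this. *)
Lemma ladj_unital A B (L : 'Hom(Op C A, Op C B)) :
  trace_preserving L -> ladj L 1%:M = 1%:M.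
Proof.
move=> tpL; apply/op_ext=> a b; rewrite entry_ladj mulmx1 trace_map_mx mxtrace_tr.
have adj1 : (1%:M : Op C A)^t* = 1%:M by rewrite trmx1 map_mx1.
rewrite tpL -[munit C a b]mul1mx -adj1 hs_munit adj1.
exact: conjCK.
Qed.

(* The unnormalised maximally entangled state. *)
Definition ment A k : Op C (A ++ [:: Wire k #|basis A|]) :=
  \sum_a \sum_b otens (munit C a b)
    (@munit C [:: Wire k #|basis A|] (enum_rank a, tt) (enum_rank b, tt)).

Lemma psd_ment A k : psd (ment A k).
Proof.
(* [g] is the vector pairing each basis vector of [A] with its copy on the ancilla; [ment] is its
   rank-one operator. *)
pose g (s : basis (A ++ [:: Wire k #|basis A|])) : C := \sum_a
  (((bsplit s).1 == a) && ((bsplit s).2 == (enum_rank a, tt)))%:R.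
have -> : ment A k = (\col_i g (enum_val i)) *m (\col_i g (enum_val i))^t*.
  have gR s : (g s)^* = g s.
    by rewrite rmorph_sum; apply: eq_bigr => a _; rewrite rmorph_nat.
  apply/op_ext=> s t; rewrite {2}/entry mxE big_ord1 !mxE !enum_rankK gR.
  rewrite /ment entry_sum big_distrlr; apply: eq_bigr => a _ /=.
  rewrite entry_sum; apply: eq_bigr => b _.
  by rewrite entry_otens !entry_munit -!natrM !mulnb andbACA.
exact: psd_gram.
Qed.

(* Choi's theorem: the values of L on the matrix units are the blocks of its *)
(* extension at the maximally entangled state, and a Gram factorisation of   *)
(* that operator is a Kraus decomposition of L.                              *)
Lemma kraus_of_ment A B k (L : 'Hom(Op C A, Op C B)) :
  psd (ltens L (\1%VF : 'End(Op C [:: Wire k #|basis A|])) (ment A k)) -> kraus L.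
Proof.
case/psd_gramP=> W eW; pose A' := [:: Wire k #|basis A|].
have [join _ joinK] := bsplit_bij B A'.
pose j s (a : basis A) := join (s, (enum_rank a, tt)).
have eL a b s t : entry (L (munit C a b)) s t =
    entry (W *m W^t* : Op C (B ++ A')) (j s a) (j t b).
  (* The ancilla indices [a] and [b] single out one summand of [ment]; all others vanish. *)
  rewrite -eW /ment linear_sum entry_sum (bigD1 a) //= linear_sum entry_sum.
  rewrite (bigD1 b) //= ltens_otens lfunE entry_otens !joinK entry_munit !eqxx mulr1.
  have nE (x y : basis A) : ((enum_rank x, tt) == (enum_rank y, tt)) = (x == y).
    by rewrite xpair_eqE eqxx andbT (inj_eq enum_rank_inj).
  rewrite big1 ?big1 ?addr0 // => [a' na|b' nb].
    rewrite linear_sum entry_sum big1 // => b' _.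
    rewrite /= ltens_otens lfunE entry_otens !joinK entry_munit !nE.
    by rewrite [a == _]eq_sym (negPf na) mulr0.
  rewrite /= ltens_otens lfunE entry_otens !joinK entry_munit !nE.
  by rewrite [b == _]eq_sym (negPf nb) andbF mulr0.
(* Each column of [W], a vector on [B ++ A'], is reshaped into a matrix from [A] to [B]. *)
exists 'I_#|basis (B ++ A')|, (fun i => \matrix_(s, a)
  W (enum_rank (j (enum_val s) (enum_val a))) i).
apply/kraus_mapP=> a b s t; rewrite eL /entry mxE.
by apply: eq_bigr => i _; rewrite !mxE !enum_rankK.
Qed.

Lemma completely_positiveP A B (L : 'Hom(Op C A, Op C B)) :
  completely_positive L <-> kraus L.
Proof.
(* The ancilla has the dimension of [A] and the label 0 fixed by [completely_positive]; operation
   classes will require a fresh label instead. *)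
split=> [cpL|kL n X]; first exact/(@kraus_of_ment _ _ 0%N)/cpL/psd_ment.
exact/kraus_psd/kraus_tens/kraus_id.
Qed.

(** * Partial transposition and its action on maps *)

Lemma eq_bmix V W A (a b : basis A) : V =1 W -> bmix V a b = bmix W a b.
Proof. by move=> eVW; elim: A a b => //= w A IH [i a] [j b] /=; rewrite eVW IH. Qed.

Lemma bmix_id V A (a : basis A) : bmix V a a = a.
Proof. by elim: A a => [[]|w A IH [i a]] //=; rewrite IH if_same. Qed.

Lemma bmix0 A (a b : basis A) : bmix pred0 a b = a.
Proof. by elim: A a b => [[] []|w A IH [i a] [j b]] //=; rewrite IH. Qed.

(** Exchanging twice on a common label cancels, which leaves the symmetric difference. *)
Lemma bmix_bmix V W A (a b : basis A) :
  bmix W (bmix V a b) (bmix V b a) = bmix (fun x => V x (+) W x) a b.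
Proof.
elim: A a b => //= w A IH [i a] [j b] /=; rewrite IH.
by case: (V _) => //=; case: (W _).
Qed.

Lemma bmixK V A (a b : basis A) : bmix V (bmix V a b) (bmix V b a) = a.
Proof.
by rewrite bmix_bmix (@eq_bmix _ pred0) ?bmix0 // => x; exact: addbb.
Qed.

Lemma bsplit_bmix V A B (k l : basis (A ++ B)) :
  bsplit (bmix V k l) = (bmix V (bsplit k).1 (bsplit l).1,
                         bmix V (bsplit k).2 (bsplit l).2).
Proof. by elim: A k l => //= w A IH [i k] [j l] /=; rewrite IH. Qed.

Lemma entry_Gamma V A (X : Op C A) a b :
  entry (Gamma C V A X) a b = entry X (bmix V a b) (bmix V b a).
Proof. by rewrite GammaE entry_mkop. Qed.

Lemma Gamma_Gamma V W A (X : Op C A) :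
  Gamma C V A (Gamma C W A X) = Gamma C (fun x => V x (+) W x) A X.
Proof. by apply/op_ext=> a b; rewrite !entry_Gamma !bmix_bmix. Qed.

Lemma Gamma0 A (X : Op C A) : Gamma C pred0 A X = X.
Proof. by apply/op_ext=> a b; rewrite entry_Gamma !bmix0. Qed.

Lemma GammaK V A : involutive (Gamma C V A).
Proof. by move=> X; apply/op_ext=> a b; rewrite !entry_Gamma !bmixK. Qed.

Lemma Gamma_munit V A a b :
  Gamma C V A (munit C a b) = munit C (bmix V a b) (bmix V b a).
Proof.
apply/op_ext=> s t; rewrite entry_Gamma !entry_munit -!xpair_eqE.
congr (nat_of_bool _)%:R; apply/eqP/eqP => -[e1 e2].
  by rewrite -e1 -e2 !bmixK.
by rewrite e1 e2 !bmixK.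
Qed.

Lemma mxtrace_Gamma V A (X : Op C A) : \tr (Gamma C V A X) = \tr X.
Proof.
apply: eq_bigr => i _.
by have := entry_Gamma V X (enum_val i) (enum_val i); rewrite bmix_id /entry enum_valK.
Qed.

Lemma Gamma_otens V A B (X : Op C A) (Y : Op C B) :
  Gamma C V (A ++ B) (otens X Y) = otens (Gamma C V A X) (Gamma C V B Y).
Proof.
by apply/op_ext=> k l; rewrite entry_Gamma !entry_otens !bsplit_bmix !entry_Gamma.
Qed.

(** [Gamma] permutes the entries by an involution of the index pairs, so it is self-adjoint. *)
Lemma hs_Gamma V A (X Y : Op C A) :
  \tr ((Gamma C V A X)^t* *m Y) = \tr (X^t* *m Gamma C V A Y).
Proof.
pose s (p : basis A * basis A) := (bmix V p.1 p.2, bmix V p.2 p.1).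
have sK : involutive s by case=> a b; rewrite /s /= !bmixK.
rewrite !hs_entry (reindex_inj (inv_inj sK)); apply: eq_bigr => -[a b] _ /=.
by rewrite !entry_Gamma !bmixK.
Qed.

Lemma sectorE V A B (L : 'Hom(Op C A, Op C B)) X :
  sector V L X = Gamma C V B (L (Gamma C V A X)).
Proof. by rewrite /sector !comp_lfunE. Qed.

Lemma sector0 A B (L : 'Hom(Op C A, Op C B)) : sector pred0 L = L.
Proof. by apply/lfunP=> X; rewrite sectorE !Gamma0. Qed.

(** Hence every sector of [sector W L] is again a sector of [L], which makes the PPT class
    sectorially closed. *)
Lemma sector_sector V W A B (L : 'Hom(Op C A, Op C B)) :
  sector V (sector W L) = sector (fun x => V x (+) W x) L.
Proof.
apply/lfunP=> X; rewrite !sectorE Gamma_Gamma; congr (Gamma _ _ _ (L _)).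
(* On the input side the transpositions compose in the opposite order, whence [addbC]. *)
rewrite Gamma_Gamma; apply/op_ext=> a b; rewrite !entry_Gamma.
by congr entry; apply: eq_bmix => x; rewrite addbC.
Qed.

Lemma sector_id V A : sector V (\1%VF : 'End(Op C A)) = \1%VF.
Proof. by apply/lfunP=> X; rewrite sectorE !id_lfunE GammaK. Qed.

Lemma sector_comp V A B D (L : 'Hom(Op C A, Op C B)) (M : 'Hom(Op C B, Op C D)) :
  sector V (M \o L) = (sector V M \o sector V L)%VF.
Proof. by apply/lfunP=> X; rewrite comp_lfunE !sectorE comp_lfunE GammaK. Qed.

Lemma sectorD V A B (L M : 'Hom(Op C A, Op C B)) x y :
  sector V (x *: L + y *: M) = x *: sector V L + y *: sector V M.
Proof.
apply/lfunP=> X; rewrite sectorE !add_lfunE !scale_lfunE !sectorE.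
by rewrite linearD !linearZ.
Qed.

Lemma sector_tens V A1 B1 A2 B2 (L : 'Hom(Op C A1, Op C B1))
    (M : 'Hom(Op C A2, Op C B2)) :
  sector V (ltens L M) = ltens (sector V L) (sector V M).
Proof.
apply/lfunP=> X; rewrite (op_sum_units X) !linear_sum; apply: eq_bigr => k _ /=.
rewrite !linear_sum; apply: eq_bigr => l _ /=; rewrite !linearZ; congr (_ *: _).
by rewrite /= sectorE munit_split Gamma_otens !ltens_otens Gamma_otens !sectorE.
Qed.

Lemma ladj_sector V A B (L : 'Hom(Op C A, Op C B)) :
  ladj (sector V L) = sector V (ladj L).
Proof.
apply/lfunP=> Y; apply/op_ext=> a b; rewrite sectorE entry_Gamma !entry_ladj.
by rewrite sectorE Gamma_munit hs_Gamma.
Qed.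

Lemma sector_tp V A B (L : 'Hom(Op C A, Op C B)) :
  trace_preserving L -> trace_preserving (sector V L).
Proof. by move=> tpL X; rewrite sectorE mxtrace_Gamma tpL mxtrace_Gamma. Qed.

(** * Complete positivity in theories with unrestricted states *)

(** Divide by the trace to reach a state; a positive operator of zero trace is zero. *)
Lemma psd_of_states A B (L : 'Hom(Op C A, Op C B)) X :
  (forall rho, state rho -> state (L rho)) -> psd X -> psd (L X).
Proof.
move=> stL pX; have [X0|trN0] := eqVneq (\tr X) 0.
  by rewrite (psd_tr0 pX X0) linear0 => v; rewrite mulmx0 mul0mx mxE.
have [|pLX _] := stL ((\tr X)^-1 *: X).
  split; last by rewrite mxtraceZ mulVf.
  by apply: (psdZ _ pX); rewrite invr_ge0; exact: psd_tr_ge0 pX.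
rewrite -[X]scale1r -(mulfV trN0) -scalerA linearZ.
by apply: psdZ pLX; exact: psd_tr_ge0 pX.
Qed.

Lemma basis_gt0 A : all (fun w => 0 < Defs.dim w)%N A -> (0 < #|basis A|)%N.
Proof.
elim: A => [_|w A IH /andP[w0 A0]] /=; first by rewrite card_unit.
by rewrite card_prod card_ord muln_gt0 w0 IH.
Qed.

Lemma exists_notin (s : seq nat) : exists k, k \notin s.
Proof.
exists (\max_(i <- s) i).+1; apply/negP=> /leq_bigmax_seq-/(_ predT id isT).
by rewrite ltnn.
Qed.

Lemma is_system_rcons A k n : is_system A -> (0 < n)%N -> k \notin map label A ->
  is_system (A ++ [:: Wire k n]).
Proof.
move=> /andP[uA A0] n0 kA.
by rewrite /is_system map_cat cat_uniq all_cat uA A0 /= n0 orbF kA.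
Qed.

Lemma valid_gpt_kraus Eff (O : op_class C) A B (L : 'Hom(Op C A, Op C B)) :
  valid_gpt (@state C) Eff O -> O A B L -> kraus L.
Proof.
move=> vO OL; have [sA sB] := gpt_systems vO OL.
(* The label must be absent from both sides for the ancilla to extend input and output to systems;
   its dimension is positive because the wires of [A] have positive dimension. *)
have [k] := exists_notin (map label (A ++ B)); rewrite map_cat mem_cat negb_or.
case/andP=> kA kB; have [_ A0] := andP sA; have n0 := basis_gt0 A0.
pose W := Wire k #|basis A|.
have sW : is_system [:: W] by rewrite /is_system /= n0.
have := gpt_tens vO (is_system_rcons sA n0 kA) (is_system_rcons sB n0 kB) OL
  (gpt_id vO sW).
move=> OLW; apply: (@kraus_of_ment _ _ k).
apply: (@psd_of_states _ _ (ltens L (\1%VF : 'End(Op C [:: W]))) (ment A k)).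
  by move=> rho; exact: (gpt_states vO OLW).
exact: psd_ment.
Qed.

(** * The completely PPT-preserving class *)

Lemma PPT_kraus A B (L : 'Hom(Op C A, Op C B)) :
  @PPT_class C A B L <-> [/\ is_system A, is_system B, trace_preserving L &
    forall V, kraus (sector V L)].
Proof.
by split=> -[sA sB tpL cpL]; split=> // V; exact/completely_positiveP.
Qed.

Lemma PPT_sectorially_closed : sectorially_closed (@PPT_class C).
Proof.
move=> V A B L [sA sB tpL cpL]; split=> [||//|W]; rewrite ?sector_sector //.
exact: sector_tp.
Qed.

Lemma PPT_effect A B (L : 'Hom(Op C A, Op C B)) E :
  PPT_class L -> effect_max E -> effect_max (ladj L E).
Proof.
move=> /PPT_kraus[_ _ tpL kL] [_ effE].
have pE V : psd (Gamma C V A (ladj L E)).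
  (* Inserting [Gamma] twice before [E] exposes the adjoint of [sector V L] acting on the positive
     operator [Gamma C V B E]. *)
  rewrite -[E](GammaK V) -sectorE -ladj_sector.
  by apply: kraus_psd (proj1 (effE V)); exact: kraus_ladj.
(* Hermiticity comes from positivity in the sector of the empty label set. *)
split=> [|V]; first by apply/hermsymmx_adj/psd_adj; have := pE pred0; rewrite Gamma0.
split=> //; rewrite -[E](GammaK V) -sectorE -ladj_sector.
(* Unitality turns the upper bound into positivity of the image of [1%:M - Gamma C V B E]. *)
rewrite -(ladj_unital (sector_tp V tpL)) -linearB.
by apply: kraus_psd (proj2 (effE V)); exact: kraus_ladj.
Qed.

Lemma PPT_valid : valid_gpt (@state C) (@effect_max C) (@PPT_class C).
Proof.
split.
- by move=> A B L [].
- by move=> A B L [].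
- move=> A sA; apply/PPT_kraus; split=> // [X|V]; first by rewrite lfunE.
  by rewrite sector_id; exact: kraus_id.
- move=> A B L M t /andP[t0 t1] /PPT_kraus[sA sB tpL kL] /PPT_kraus[_ _ tpM kM].
  apply/PPT_kraus; split=> // [X|V].
    rewrite add_lfunE !scale_lfunE mxtraceD !mxtraceZ tpL tpM.
    by rewrite -mulrDl addrC subrK mul1r.
  by rewrite sectorD; apply: kraus_conic; rewrite ?subr_ge0.
- move=> A B D L M /PPT_kraus[sA _ tpL kL] /PPT_kraus[_ sD tpM kM].
  apply/PPT_kraus; split=> // [X|V]; first by rewrite comp_lfunE tpM tpL.
  by rewrite sector_comp; exact: kraus_comp.
- move=> A1 B1 A2 B2 L M sA sB /PPT_kraus[_ _ tpL kL] /PPT_kraus[_ _ tpM kM].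
  apply/PPT_kraus; split=> // [X|V]; last by rewrite sector_tens; exact: kraus_tens.
  rewrite (op_sum_units X) !linear_sum; apply: eq_bigr => k _ /=.
  rewrite !linear_sum; apply: eq_bigr => l _ /=; rewrite !linearZ; congr (_ * _).
  by rewrite /= munit_split ltens_otens !mxtrace_otens tpL tpM.
- move=> A B L rho /PPT_kraus[_ _ tpL kL] [prho trho].
  split; last by rewrite tpL.
  (* The empty label set gives complete positivity of [L] itself. *)
  by apply: kraus_psd prho; rewrite -(sector0 L).
- by move=> A B L E; exact: PPT_effect.
Qed.

End Kraus.

Local Open Scope complex_scope.

Theorem corollary23 (R : realType) :
  (forall O' : op_class R[i],
     valid_gpt (@state R[i]) (@effect_max R[i]) O' ->
     sectorially_closed O' ->
     sub_class O' (@PPT_class R[i]))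
  /\ (valid_gpt (@state R[i]) (@effect_max R[i]) (@PPT_class R[i])
      /\ sectorially_closed (@PPT_class R[i])).
Proof.
split=> [O' vO sO A B L OL|].
  have [sA sB] := gpt_systems vO OL; apply/PPT_kraus; split=> // [|V].
    exact: (gpt_tp vO OL).
  exact/(valid_gpt_kraus vO)/sO.
by split; [exact: PPT_valid | exact: PPT_sectorially_closed].
Qed.
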